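(* Let $e_1,\dots,e_p$ be unit vectors in $\mathbb{C}^m$ and $f_1,\dots,f_p$ unit vectors in $\mathbb{C}^n$, with $f_1,\dots,f_p$ linearly independent. Order them so that $[e_1],\dots,[e_q]$ are distinct and for each $i>q$, $[e_i]$ equals one of $[e_1],\dots,[e_q]$. For $1\le i\le q$ let $F_i$ be the face of $S$ generated by $\{\omega_{e_j\otimes f_j}:1\le j\le p,\ [e_j]=[e_i]\}$. Then each $F_i$ is also a face of $K$, and $F_i$ is affinely isomorphic to the state space of $\mathcal{B}(L_i)$, where $L_i=e_i\otimes\operatorname{Span}\{f_j:[e_j]=[e_i]\}$. Moreover the face $F$ of $S$ generated by $\{\omega_{e_i\otimes f_i}:1\le i\le p\}$ is the direct convex sum of $F_1,\dots,F_q$. In the special case where $[e_1],\dots,[e_p]$ are all distinct, $F$ is the convex hull of $\{\omega_{e_i\otimes f_i}:1\le i\le p\}$ and $F$ is a simplex.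
   Context: $K$ is the state space of $\mathcal{B}(\mathbb{C}^m\otimes\mathbb{C}^n)\cong\mathcal{B}(\mathbb{C}^m)\otimes\mathcal{B}(\mathbb{C}^n)$ and $S\subseteq K$ is the convex set of separable states (convex combinations of pure product states $\omega_{x\otimes y}$, where $\omega_z(A)=(Az,z)$ for a unit vector $z$). $[x]$ is the line spanned by $x$. The face generated by a subset is the smallest face containing it. A convex set $C$ is the direct convex sum of convex subsets $C_1,\dots,C_q$ if each point of $C$ has a unique expression $\sum_{i\in I}\lambda_i\omega_i$ with $I\subseteq\{1,\dots,q\}$, $\lambda_i>0$, $\sum\lambda_i=1$, $\omega_i\in C_i$; a simplex is a direct convex sum of finitely many points. *)

(* Defs.v *)
(* Scalars: an arbitrary numClosedFieldType C (plays the role of the complex numbers). *)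
From HB Require Import structures.
From mathcomp Require Export all_boot all_order all_algebra.
Set Implicit Arguments. Unset Strict Implicit. Unset Printing Implicit Defensive.
Export Order.TTheory GRing.Theory Num.Theory.

Local Open Scope ring_scope.

Section QDefs.
Variable C : numClosedFieldType.

(* Functionals on B(C^N) = 'M[C]_N, and "sets" of functionals. *)
Definition Func (N : nat) := 'M[C]_N -> C.
Definition fset (N : nat) := Func N -> Prop.

(* conjugate transpose *)
Definition adjmx (r s : nat) (A : 'M[C]_(r, s)) : 'M[C]_(s, r) :=
  (map_mx (fun x : C => x^*) A)^T.

(* a state of B(C^N): linear, positive, unital functional *)
Definition is_state (N : nat) (w : Func N) : Prop :=
  (forall (a : C) (A B : 'M[C]_N), w (a *: A + B) = a * w A + w B) /\
  (forall A : 'M[C]_N, 0 <= w (adjmx A *m A)) /\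
  w 1%:M = 1.

(* state space of B(C^N) *)
Definition state_space (N : nat) : fset N := fun w => is_state w.

Definition unit_vec (r : nat) (x : 'cV[C]_r) : Prop := adjmx x *m x = 1%:M.

(* x (x) y in C^m (x) C^n == C^(m*n) *)
Definition tens (r s : nat) (x : 'cV[C]_r) (y : 'cV[C]_s) : 'cV[C]_(r * s) :=
  (mxvec (x *m y^T))^T.

(* vector state omega_z(A) = (A z, z) *)
Definition vstate (N : nat) (z : 'cV[C]_N) : Func N :=
  fun A => (adjmx z *m (A *m z)) 0 0.

(* [x] = [y] : same line *)
Definition same_line (r : nat) (x y : 'cV[C]_r) : bool := (x^T == y^T)%MS.

Definition fsubset (N : nat) (X Y : fset N) : Prop := forall w, X w -> Y w.

Definition segment (N : nat) (t : C) (x y : Func N) : Func N :=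
  fun A => t * x A + (1 - t) * y A.

Definition convex (N : nat) (X : fset N) : Prop :=
  forall x y t, X x -> X y -> 0 <= t <= 1 -> X (segment t x y).

(* F is a face of the convex set K *)
Definition is_face (N : nat) (K F : fset N) : Prop :=
  fsubset F K /\ convex F /\
  forall x y t, K x -> K y -> 0 < t < 1 -> F (segment t x y) -> F x /\ F y.

(* the face of K generated by X: smallest face of K containing X *)
Definition face_gen (N : nat) (K X : fset N) : fset N :=
  fun w => forall F, is_face K F -> fsubset X F -> F w.

Definition convex_comb (N k : nat) (lam : 'I_k -> C) (v : 'I_k -> Func N) : Func N :=
  fun A => \sum_(i < k) lam i * v i A.

Definition cc_weights (k : nat) (lam : 'I_k -> C) : Prop :=
  (forall i, 0 <= lam i) /\ \sum_(i < k) lam i = 1.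

Definition convex_hull (N : nat) (X : fset N) : fset N :=
  fun w => exists k (lam : 'I_k -> C) (v : 'I_k -> Func N),
    cc_weights lam /\ (forall i, X (v i)) /\ w = convex_comb lam v.

(* separable states of B(C^m (x) C^n) *)
Definition separable (r s : nat) : fset (r * s) :=
  fun w => exists k (lam : 'I_k -> C) (x : 'I_k -> 'cV[C]_r) (y : 'I_k -> 'cV[C]_s),
    cc_weights lam /\ (forall i, unit_vec (x i) /\ unit_vec (y i)) /\
    w = convex_comb lam (fun i => vstate (tens (x i) (y i))).

(* affine isomorphism between convex sets X and Y *)
Definition affinely_isomorphic (N1 N2 : nat) (X : fset N1) (Y : fset N2) : Prop :=
  exists phi : Func N1 -> Func N2,
    (forall x, X x -> Y (phi x)) /\
    (forall x y, X x -> X y -> phi x = phi y -> x = y) /\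
    (forall z, Y z -> exists2 x, X x & phi x = z) /\
    (forall x y t, X x -> X y -> 0 <= t <= 1 ->
        phi (segment t x y) = segment t (phi x) (phi y)).

Definition dcs_expr (N q : nat) (I : {set 'I_q}) (lam : 'I_q -> C) (w : 'I_q -> Func N)
  : Func N := fun A => \sum_(i in I) lam i * w i A.

Definition dcs_valid (N q : nat) (Cs : 'I_q -> fset N)
  (I : {set 'I_q}) (lam : 'I_q -> C) (w : 'I_q -> Func N) : Prop :=
  (forall i, i \in I -> 0 < lam i /\ Cs i (w i)) /\ \sum_(i in I) lam i = 1.

(* X is the direct convex sum of the convex subsets Cs 0, ..., Cs (q-1) *)
Definition direct_convex_sum (N q : nat) (X : fset N) (Cs : 'I_q -> fset N) : Prop :=
  (forall i, fsubset (Cs i) X /\ convex (Cs i)) /\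
  forall x, X x ->
    (exists I lam w, dcs_valid Cs I lam w /\ x = dcs_expr I lam w) /\
    (forall I lam w I' lam' w',
       dcs_valid Cs I lam w -> dcs_valid Cs I' lam' w' ->
       x = dcs_expr I lam w -> x = dcs_expr I' lam' w' ->
       I = I' /\ forall i, i \in I -> lam i = lam' i /\ w i = w' i).

(* a simplex: direct convex sum of finitely many points *)
Definition simplex (N : nat) (X : fset N) : Prop :=
  exists r (v : 'I_r -> Func N), direct_convex_sum X (fun i => fun w => w = v i).

(* matrix whose rows span L = e (x) Span{ f_j : [e_j] = [e] } *)
Definition L_mx (r s p : nat) (e : 'I_p -> 'cV[C]_r) (f : 'I_p -> 'cV[C]_s)
  (e0 : 'cV[C]_r) : 'M[C]_(p, r * s) :=
  \matrix_(j < p) (if same_line (e j) e0 then (tens e0 (f j))^T else 0).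

End QDefs.
Arguments state_space C N : clear implicits.
Arguments separable C r s : clear implicits.

(* Main.v *)
(* A state of a matrix algebra factors as [A |-> tr (Z^* A Z)], and the states
   whose [Z] has its columns in a fixed subspace form a face of the state space:
   the zero set of a positive functional.  A product vector in the span of the
   [e_j (x) f_j] must, by pairing with the dual basis of [f], lie in the span of
   those with [e_j] on one single line, that is, in some [L_i].  Hence a separable
   state supported on the whole span is a mixture of states supported on the
   [L_i], and all states supported on [L_i] are separable.  The [L_i] are linearly
   independent, so compressing by the oblique projection onto [L_i] recovers the
   i-th component of a mixture, which gives uniqueness. *)
Require Import Defs.
From mathcomp Require Import ring.
From Stdlib Require Import FunctionalExtensionality PropExtensionality.
Import Order.TTheory GRing.Theory Num.Theory.
Set Implicit Arguments.
Unset Strict Implicit.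
Unset Printing Implicit Defensive.
Local Open Scope ring_scope.

(** * Adjoints and the Frobenius norm *)

Lemma adjmxE (C : numClosedFieldType) r s (A : 'M[C]_(r, s)) i j :
  adjmx A i j = (A j i)^*.
Proof. by rewrite !mxE. Qed.

Lemma adjmxM (C : numClosedFieldType) r s t (A : 'M[C]_(r, s)) (B : 'M[C]_(s, t)) :
  adjmx (A *m B) = adjmx B *m adjmx A.
Proof. by rewrite /adjmx map_mxM trmx_mul. Qed.

Lemma adjmxK (C : numClosedFieldType) r s (A : 'M[C]_(r, s)) : adjmx (adjmx A) = A.
Proof. by apply/matrixP=> i j; rewrite !adjmxE conjCK. Qed.

Lemma adjmxZ (C : numClosedFieldType) r s a (A : 'M[C]_(r, s)) :
  adjmx (a *: A) = a^* *: adjmx A.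
Proof. by apply/matrixP=> i j; rewrite !mxE rmorphM. Qed.

Lemma adjmx_tr (C : numClosedFieldType) r s (A : 'M[C]_(r, s)) :
  adjmx A^T = (adjmx A)^T.
Proof. by apply/matrixP=> i j; rewrite !mxE. Qed.

Lemma trmx_adjE (C : numClosedFieldType) r s (A : 'M[C]_(r, s)) :
  (map_mx Num.conj A^T) = adjmx A.
Proof. by apply/matrixP=> i j; rewrite !mxE. Qed.

Lemma adjmx_delta (C : numClosedFieldType) r s (i : 'I_r) (j : 'I_s) :
  adjmx (delta_mx i j : 'M[C]_(r, s)) = delta_mx j i.
Proof. by apply/matrixP=> a b; rewrite !mxE rmorph_nat andbC. Qed.

(** The square of the norm, so that no root occurs; on a column it is the squared Euclidean
    length. *)
Definition frob (C : numClosedFieldType) r s (A : 'M[C]_(r, s)) : C :=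
  \tr (adjmx A *m A).

Lemma frobE (C : numClosedFieldType) r s (A : 'M[C]_(r, s)) :
  frob A = \sum_i \sum_j `|A j i| ^+ 2.
Proof.
apply: eq_bigr => i _; rewrite !mxE; apply: eq_bigr => j _.
by rewrite adjmxE normCK mulrC.
Qed.

Lemma frob_ge0 (C : numClosedFieldType) r s (A : 'M[C]_(r, s)) : 0 <= frob A.
Proof.
by rewrite frobE; apply: sumr_ge0 => i _; apply: sumr_ge0 => j _; rewrite exprn_ge0.
Qed.

Lemma frob_eq0 (C : numClosedFieldType) r s (A : 'M[C]_(r, s)) :
  frob A = 0 -> A = 0.
Proof.
rewrite frobE => /eqP; rewrite psumr_eq0; last first.
  by move=> i _; apply: sumr_ge0 => j _; rewrite exprn_ge0.
move=> /allP A0; apply/matrixP=> j i; rewrite !mxE.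
have := A0 i (mem_index_enum i); rewrite psumr_eq0 /=; last first.
  by move=> k _; rewrite exprn_ge0.
move=> /allP/(_ j (mem_index_enum j)) /=.
by rewrite expf_eq0 /= normr_eq0 => /eqP.
Qed.

Lemma frob0 (C : numClosedFieldType) r s : frob (0 : 'M[C]_(r, s)) = 0.
Proof. by rewrite /frob mulmx0 mxtrace0. Qed.

Lemma frobZ (C : numClosedFieldType) r s a (A : 'M[C]_(r, s)) :
  frob (a *: A) = `|a| ^+ 2 * frob A.
Proof.
by rewrite /frob adjmxZ -scalemxAl -scalemxAr scalerA mxtraceZ normCK [a * _]mulrC.
Qed.

Lemma frob_col (C : numClosedFieldType) r s (A : 'M[C]_(r, s)) :
  frob A = \sum_k frob (col k A).
Proof.
rewrite frobE; apply: eq_bigr => k _; rewrite frobE big_ord1.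
by apply: eq_bigr => j _; rewrite mxE.
Qed.

Lemma unit_vec_frob (C : numClosedFieldType) r (x : 'cV[C]_r) :
  unit_vec x <-> frob x = 1.
Proof.
split=> [xu|]; first by rewrite /frob xu mxtrace1.
by rewrite /frob trace_mx11 => x1; apply/matrixP=> i j; rewrite !ord1 x1 mxE.
Qed.

Lemma unit_vec_neq0 (C : numClosedFieldType) r (x : 'cV[C]_r) :
  unit_vec x -> x != 0.
Proof.
move=> /unit_vec_frob x1; apply: contra_eq_neq x1 => ->.
by rewrite frob0 eq_sym oner_eq0.
Qed.

(** Cauchy-Schwarz in each entry. It serves to dominate one state by a multiple of another. *)
Lemma frobM_le (C : numClosedFieldType) r s t (A : 'M[C]_(r, s)) (B : 'M[C]_(s, t)) :
  frob (A *m B) <= frob A * frob B.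
Proof.
have -> : frob A = \sum_j \sum_k `|A j k| ^+ 2 by rewrite frobE exchange_big.
rewrite [frob (A *m B)]frobE [frob B]frobE mulr_sumr; apply: ler_sum => i _.
rewrite mulr_suml; apply: ler_sum => j _.
pose u := row j A; pose v := adjmx (col i B).
have : `|dotmx u v| ^+ 2 <= dotmx u u * dotmx v v.
  exact: leif_le (CauchySchwarz (@dotmx C s) u v).
rewrite !dotmxE !trmx_adjE adjmxK.
congr (_ <= _).
  congr (`|_| ^+ 2); rewrite !mxE; apply: eq_bigr => k _; by rewrite !mxE.
congr (_ * _); rewrite !mxE; apply: eq_bigr => k _; rewrite !mxE.
  by rewrite normCK.
by rewrite normCK mulrC.
Qed.

(** * Positive semidefinite matrices *)

Lemma psd_hermitian (C : numClosedFieldType) N (D : 'M[C]_N) :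
  (forall x : 'cV_N, 0 <= (adjmx x *m D *m x) 0 0) -> adjmx D = D.
Proof.
move=> psd; apply/matrixP=> i j; rewrite adjmxE.
pose q (x y : 'cV[C]_N) := (adjmx x *m D *m y) 0 0.
have qreal x : (q x x)^* = q x x by apply/CrealP/ger0_real/psd.
pose d k : 'cV[C]_N := delta_mx k 0.
have qd k l : q (d k) (d l) = D k l.
  rewrite /q /d -[_ *m D *m _]mulmxA -colE.
  rewrite adjmx_delta.
  by rewrite -rowE !mxE.
have qexp c : q (d i + c *: d j) (d i + c *: d j)
    = D i i + c * D i j + c^* * D j i + c^* * c * D j j.
  rewrite -!qd /q.
  have -> : adjmx (d i + c *: d j) = adjmx (d i) + c^* *: adjmx (d j).
    by apply/matrixP=> a b; rewrite !mxE rmorphD rmorphM.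
  rewrite !mulmxDl !mulmxDr -!scalemxAl -!scalemxAr !scalerA !mxE; ring.
have rD k : (D k k)^* = D k k by rewrite -qd; apply: qreal.
(* Polarisation: reality of the form at [d i + d j] and at [d i + 'i *: d j] gives two linear
   relations between [D i j], [D j i] and their conjugates. *)
have h1 := qreal (d i + 1 *: d j).
have h2 := qreal (d i + 'i *: d j).
move: h1 h2; rewrite !qexp !rmorphD !rmorphM /= !rD !conjCK conjCi !rmorph1 !mul1r.
move=> /eqP h1 /eqP h2.
have {}h1 : (D i j)^* + (D j i)^* = D i j + D j i.
  by apply/eqP; rewrite -subr_eq0; rewrite -subr_eq0 in h1; rewrite -(eqP h1); apply/eqP; ring.
have {}h2 : 'i * ((D j i)^* - (D i j)^*) = 'i * (D i j - D j i).
  by apply/eqP; rewrite -subr_eq0; rewrite -subr_eq0 in h2; rewrite -(eqP h2); apply/eqP; ring.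
have {}h2 := mulfI (neq0Ci C) h2.
have : 2%:R * (D j i)^* = 2%:R * D i j.
  transitivity ((D i j)^* + (D j i)^* + ((D j i)^* - (D i j)^*)); first by ring.
  by rewrite h1 h2; ring.
by move/(mulfI (negbT (pnatr_eq0 C 2))).
Qed.

(** By the spectral theorem [D = P^* diag(d) P] with [P] unitary. Each eigenvalue is a value of the
    form, hence nonnegative, and [P^* diag(sqrt d)] serves as [Z]. *)
Lemma psd_factor (C : numClosedFieldType) N (D : 'M[C]_N) :
  (forall x : 'cV_N, 0 <= (adjmx x *m D *m x) 0 0) ->
  exists Z : 'M[C]_N, D = Z *m adjmx Z.
Proof.
move=> psd; have hD := psd_hermitian psd.
have /orthomx_spectralP : D \is normalmx by apply/normalmxP; rewrite trmx_adjE hD.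
have PU := spectral_unitarymx D; set P := spectralmx D in PU *.
set d := spectral_diag D; rewrite (invmx_unitary PU) trmx_adjE => eD.
have PP : P *m adjmx P = 1%:M by rewrite -trmx_adjE; apply/unitarymxP.
have d_ge0 k : 0 <= d 0 k.
  have := psd (adjmx P *m delta_mx k 0).
  rewrite eD adjmxM adjmxK !mulmxA -[_ *m P *m adjmx P]mulmxA PP mulmx1.
  rewrite -[_ *m P *m adjmx P]mulmxA PP mulmx1.
  rewrite adjmx_delta.
  by rewrite -mulmxA -colE -rowE !mxE eqxx.
exists (adjmx P *m diag_mx (\row_k sqrtC (d 0 k))).
rewrite adjmxM adjmxK mulmxA -[_ *m diag_mx _ *m adjmx (diag_mx _)]mulmxA.
rewrite [in LHS]eD; congr (_ *m _ *m _).
have -> : adjmx (diag_mx (\row_k sqrtC (d 0 k))) = diag_mx (\row_k sqrtC (d 0 k)).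
  apply/matrixP=> a b; rewrite !mxE eq_sym; have [->|_] := eqVneq b a.
    by rewrite mulr1n; apply/CrealP/ger0_real; rewrite sqrtC_ge0.
  by rewrite mulr0n rmorph0.
rewrite mulmx_diag; congr diag_mx; apply/rowP=> k.
by rewrite !mxE -expr2 sqrtCK.
Qed.

(** * States given by a factor of their density matrix *)

(** The density matrix is [Z *m adjmx Z]. The number of columns is left free, so that single columns
    and compressions [R *m Z] have the same form. *)
Definition gram_state (C : numClosedFieldType) N k (Z : 'M[C]_(N, k)) : Func C N :=
  fun A => \tr (adjmx Z *m A *m Z).

Lemma gram_stateZD (C : numClosedFieldType) N k (Z : 'M[C]_(N, k)) a A B :
  gram_state Z (a *: A + B) = a * gram_state Z A + gram_state Z B.
Proof.
by rewrite /gram_state mulmxDr mulmxDl mxtraceD -scalemxAr -scalemxAl mxtraceZ.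
Qed.

Lemma gram_state_sq (C : numClosedFieldType) N k r (Z : 'M[C]_(N, k)) (B : 'M[C]_(r, N)) :
  gram_state Z (adjmx B *m B) = frob (B *m Z).
Proof. by rewrite /gram_state /frob adjmxM !mulmxA. Qed.

Lemma gram_state1 (C : numClosedFieldType) N k (Z : 'M[C]_(N, k)) :
  gram_state Z 1%:M = frob Z.
Proof. by rewrite /gram_state mulmx1. Qed.

Lemma gram_state_is_state (C : numClosedFieldType) N k (Z : 'M[C]_(N, k)) :
  frob Z = 1 -> is_state (gram_state Z).
Proof.
move=> Z1; split; first exact: gram_stateZD.
by split=> [A|]; rewrite ?gram_state_sq ?frob_ge0 // gram_state1.
Qed.

Lemma gram_state_compress (C : numClosedFieldType) N k r (Z : 'M[C]_(N, k))
    (R : 'M[C]_(r, N)) A :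
  gram_state Z (adjmx R *m A *m R) = gram_state (R *m Z) A.
Proof. by rewrite /gram_state adjmxM !mulmxA. Qed.

Lemma gram_stateZ (C : numClosedFieldType) N k a (Z : 'M[C]_(N, k)) A :
  gram_state (a *: Z) A = `|a| ^+ 2 * gram_state Z A.
Proof.
by rewrite /gram_state adjmxZ -!scalemxAl -scalemxAr scalerA mxtraceZ normCK [a * _]mulrC.
Qed.

Lemma gram_state_col (C : numClosedFieldType) N k (Z : 'M[C]_(N, k)) A :
  gram_state Z A = \sum_i gram_state (col i Z) A.
Proof.
apply: eq_bigr => i _; rewrite /gram_state trace_mx11 -!mulmxA !mxE.
apply: eq_bigr => j _; rewrite !mxE; congr (_ * _).
by apply: eq_bigr => l _; rewrite !mxE.
Qed.

Lemma vstate_gram (C : numClosedFieldType) N (z : 'cV[C]_N) : vstate z = gram_state z.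
Proof.
by apply: functional_extensionality => A; rewrite /vstate /gram_state trace_mx11 mulmxA.
Qed.

Lemma state_sum (C : numClosedFieldType) N (w : Func C N) (I : finType)
    (a : I -> C) (A : I -> 'M[C]_N) :
  is_state w -> w (\sum_i a i *: A i) = \sum_i a i * w (A i).
Proof.
move=> [lin _]; have w0 : w 0 = 0.
  have := lin 1 0 0; rewrite scaler0 addr0 mul1r => /eqP.
  by rewrite -subr_eq0 opprD addrA subrr sub0r oppr_eq0 => /eqP.
apply: (big_ind2 (fun B b => w B = b)) => // [B b B' b' <- <-|i _].
  by have := lin 1 B B'; rewrite scale1r mul1r.
by have := lin (a i) (A i) 0; rewrite addr0 w0 addr0.
Qed.

(** The values of [w] on the matrix units form a density matrix, and positivity of [w] at
    [x *m adjmx x] makes it positive semidefinite. *)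
Lemma state_factor (C : numClosedFieldType) N (w : Func C N) :
  is_state w -> exists2 Z : 'M[C]_N, frob Z = 1 & w = gram_state Z.
Proof.
move=> st; have [_ [pos w1]] := st.
pose D : 'M[C]_N := \matrix_(i, j) w (delta_mx j i).
have wD A : w A = \tr (D *m A).
  rewrite {1}[A]matrix_sum_delta pair_bigA /= (state_sum _ _ st).
  rewrite -(pair_bigA _ (fun i j => A i j * w (delta_mx i j))) exchange_big.
  apply: eq_bigr => j _; rewrite !mxE; apply: eq_bigr => i _.
  by rewrite mxE mulrC.
have psd (x : 'cV_N) : 0 <= (adjmx x *m D *m x) 0 0.
  rewrite -trace_mx11 -mulmxA mxtrace_mulC -mulmxA -wD.
  (* Positivity of [w] speaks of square matrices only, so [adjmx x] is made the first row of a
     square matrix, which requires a positive size. *)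
  case: N w st pos w1 D wD x => [|N] w st pos w1 D wD x.
    by rewrite [x *m _]flatmx0; have := pos 0; rewrite mulmx0.
  have := pos (delta_mx 0 0 *m adjmx x).
  rewrite adjmxM adjmxK -mulmxA [adjmx (delta_mx _ _) *m _]mulmxA.
  suff -> : adjmx (delta_mx 0 0 : 'cV[C]_N.+1) *m delta_mx 0 0 = 1%:M.
    by rewrite mul1mx.
  rewrite adjmx_delta.
  by rewrite mul_delta_mx; apply/matrixP=> a b; rewrite !mxE !ord1.
have [Z DZ] := psd_factor psd.
have wZ : w = gram_state Z.
  apply: functional_extensionality => A.
  by rewrite wD DZ /gram_state -mulmxA mxtrace_mulC.
by exists Z; rewrite // -gram_state1 -wZ.
Qed.

(** * States supported on a subspace *)

Lemma is_state_segment (C : numClosedFieldType) N (x y : Func C N) t :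
  is_state x -> is_state y -> 0 <= t <= 1 -> is_state (segment t x y).
Proof.
move=> [lx [px x1]] [ly [py y1]] /andP[t0 t1]; rewrite /segment; split.
  by move=> a A B; rewrite lx ly; ring.
split=> [A|]; last by rewrite x1 y1; ring.
by rewrite addr_ge0 // mulr_ge0 // subr_ge0.
Qed.

(* [supported M] is the set of states whose density matrix has range in the
   row space of [M]. *)
Definition supported (C : numClosedFieldType) N r (M : 'M[C]_(r, N)) : fset C N :=
  fun w => exists k (Z : 'M[C]_(N, k)),
    [/\ (Z^T <= M)%MS, frob Z = 1 & w = gram_state Z].

(** Acts on columns: its kernel consists of the transposes of the row space of [M]. *)
Definition annih (C : numClosedFieldType) N r (M : 'M[C]_(r, N)) : 'M[C]_N :=
  (cokermx M)^T.

Lemma annihP (C : numClosedFieldType) N r k (M : 'M[C]_(r, N)) (Z : 'M[C]_(N, k)) :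
  reflect (annih M *m Z = 0) (Z^T <= M)%MS.
Proof.
rewrite submxE; apply: (iffP eqP) => [h|h].
  by apply: trmx_inj; rewrite trmx_mul trmxK h trmx0.
by rewrite -[cokermx M]trmxK -trmx_mul h trmx0.
Qed.

(** At [gram_state Z] this is the squared norm of [annih M *m Z]. It is linear in [w] and
    nonnegative on states, so its zero set is a face. *)
Definition defect (C : numClosedFieldType) N r (M : 'M[C]_(r, N)) (w : Func C N) : C :=
  w (adjmx (annih M) *m annih M).

Lemma gram_defect (C : numClosedFieldType) N r k (M : 'M[C]_(r, N)) (Z : 'M[C]_(N, k)) :
  (defect M (gram_state Z) == 0) = (Z^T <= M)%MS.
Proof.
rewrite /defect gram_state_sq; apply/eqP/annihP => [/frob_eq0 //|->].
exact: frob0.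
Qed.

Lemma defect_ge0 (C : numClosedFieldType) N r (M : 'M[C]_(r, N)) (w : Func C N) :
  is_state w -> 0 <= defect M w.
Proof. by move=> [_ [pos _]]; apply: pos. Qed.

Lemma supportedP (C : numClosedFieldType) N r (M : 'M[C]_(r, N)) (w : Func C N) :
  supported M w <-> is_state w /\ defect M w = 0.
Proof.
split=> [[k [Z [ZM Z1 ->]]]|[st d0]].
  by split; [apply: gram_state_is_state | apply/eqP; rewrite gram_defect].
have [Z Z1 wZ] := state_factor st.
by exists N, Z; split=> //; rewrite -gram_defect -wZ d0.
Qed.

Lemma defect_segment (C : numClosedFieldType) N r (M : 'M[C]_(r, N)) (x y : Func C N) t :
  is_state x -> is_state y -> 0 < t < 1 ->
  defect M (segment t x y) = 0 -> defect M x = 0 /\ defect M y = 0.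
Proof.
move=> sx sy /andP[t0 t1] /eqP.
have u0 : 0 < 1 - t by rewrite subr_gt0.
have dx := defect_ge0 M sx; have dy := defect_ge0 M sy.
rewrite [defect _ _]/(_ + _) paddr_eq0; [|exact: mulr_ge0 (ltW t0) dx|exact: mulr_ge0 (ltW u0) dy].
by rewrite !mulf_eq0 (gt_eqF t0) (gt_eqF u0) => /andP[/eqP dx0 /eqP dy0].
Qed.

Lemma defect_segment0 (C : numClosedFieldType) N r (M : 'M[C]_(r, N)) (x y : Func C N) t :
  defect M x = 0 -> defect M y = 0 -> defect M (segment t x y) = 0.
Proof. by rewrite /defect /segment => -> ->; rewrite !mulr0 addr0. Qed.

Lemma supported_face (C : numClosedFieldType) N r (M : 'M[C]_(r, N)) :
  is_face (state_space C N) (supported M).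
Proof.
split; first by move=> w /supportedP[].
split=> [x y t /supportedP[sx dx] /supportedP[sy dy] t01|x y t sx sy t01].
  apply/supportedP; split; first exact: is_state_segment.
  exact: defect_segment0.
move=> /supportedP[_ /(defect_segment sx sy t01)[dx dy]].
by split; apply/supportedP.
Qed.

Lemma supported_eqmx (C : numClosedFieldType) N r s (M : 'M[C]_(r, N)) (M' : 'M[C]_(s, N)) :
  (M :=: M')%MS -> supported M = supported M'.
Proof.
move=> eqM; apply: functional_extensionality => w; apply: propositional_extensionality.
by split=> -[k [Z [ZM Z1 wZ]]]; exists k, Z; split=> //; rewrite ?eqM // -eqM.
Qed.

(** Gram-Schmidt yields an isometry [W] onto the subspace. States are pulled back along
    [B |-> W *m B *m adjmx W], and [Y |-> W *m Y] on factors inverts this. *)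
Lemma supported_isomorphic (C : numClosedFieldType) N r (M : 'M[C]_(r, N)) :
  affinely_isomorphic (supported M) (state_space C (\rank M)).
Proof.
pose V := schmidt (row_base M).
have VU : V *m adjmx V = 1%:M.
  rewrite -trmx_adjE; apply/unitarymxP; apply: schmidt_unitarymx.
  exact: rank_leq_col.
have VM : (V :=: M)%MS.
  exact: eqmx_trans (eqmx_schmidt_free (row_base_free M)) (eq_row_base M).
pose W := V^T.
have WW : adjmx W *m W = 1%:M.
  by rewrite /W adjmx_tr -trmx_mul VU trmx1.
(* [W *m adjmx W] is the orthogonal projection onto the subspace. *)
have WZ k (Z : 'M[C]_(N, k)) : (Z^T <= M)%MS -> W *m adjmx W *m Z = Z.
  rewrite -VM => /submxP[Y ZY].
  have -> : Z = W *m Y^T by rewrite -[Z]trmxK ZY trmx_mul.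
  by rewrite -!mulmxA [adjmx W *m _]mulmxA WW mul1mx.
exists (fun w B => w (W *m B *m adjmx W)).
have phiE k (Z : 'M[C]_(N, k)) B :
    gram_state Z (W *m B *m adjmx W) = gram_state (adjmx W *m Z) B.
  by rewrite -gram_state_compress adjmxK.
split.
  move=> w [k [Z [ZM Z1 ->]]].
  have -> : (fun B => gram_state Z (W *m B *m adjmx W)) = gram_state (adjmx W *m Z).
    by apply: functional_extensionality => B.
  apply: gram_state_is_state.
  by rewrite /frob adjmxM adjmxK -!mulmxA [W *m _]mulmxA WZ.
split.
  move=> w w' [k [Z [ZM Z1 ->]]] [k' [Z' [ZM' Z1' ->]]] eqw.
  apply: functional_extensionality => A.
  have := congr1 (fun g => g (adjmx W *m A *m W)) eqw.
  by rewrite /= !phiE !gram_state_compress !mulmxA !WZ.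
split.
  move=> z /state_factor[Y Y1 ->]; exists (gram_state (W *m Y)).
    exists (\rank M), (W *m Y); split=> //.
      by rewrite trmx_mul trmxK -VM submxMl.
    by rewrite /frob adjmxM mulmxA -[_ *m adjmx W *m _]mulmxA WW mulmx1.
  by apply: functional_extensionality => B; rewrite phiE mulmxA WW mul1mx.
by move=> x y t _ _ _.
Qed.

(** * Convex combinations and generated faces *)

Lemma convex_comb_in (C : numClosedFieldType) N (X : fset C N) k (lam : 'I_k -> C) v :
  convex X -> cc_weights lam -> (forall i, X (v i)) -> X (convex_comb lam v).
Proof.
move=> cX; elim: k lam v => [|k IH] lam v [lam0 lam1] Xv.
  by move: lam1 => /eqP; rewrite big_ord0 eq_sym oner_eq0.
pose t := lam ord0; pose rest := fun i => lam (lift ord0 i).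
have sum_rest : \sum_i rest i = 1 - t by rewrite -lam1 big_ord_recl /t; ring.
have rest0 : 0 <= 1 - t by rewrite -sum_rest; apply: sumr_ge0 => i _; apply: lam0.
(* The tail is to be rescaled by [1 - t]; if this is zero, all weights of the tail vanish. *)
have [t1|t1] := eqVneq (1 - t) 0.
  suff -> : convex_comb lam v = v ord0 by [].
  have r0 i : rest i = 0.
    move/eqP: sum_rest; rewrite t1 psumr_eq0; last by move=> *; apply: lam0.
    by move=> /allP/(_ i (mem_index_enum i))/eqP.
  apply: functional_extensionality => A; rewrite /convex_comb big_ord_recl.
  rewrite big1 => [|i _]; last by rewrite -[lam _]/(rest i) r0 mul0r.
  have -> : lam ord0 = 1 by apply/esym/eqP; rewrite -subr_eq0 t1.
  by rewrite mul1r addr0.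
have -> : convex_comb lam v =
   segment t (v ord0) (convex_comb (fun i => rest i / (1 - t)) (fun i => v (lift ord0 i))).
  apply: functional_extensionality => A.
  rewrite /segment /convex_comb big_ord_recl mulr_sumr; congr (_ + _).
  by apply: eq_bigr => i _; rewrite mulrA mulrCA divff // mulr1.
apply: cX => //.
  apply: IH => //; split=> [i|]; first by rewrite divr_ge0 // lam0.
  by rewrite -mulr_suml sum_rest divff.
by rewrite lam0 /= -subr_ge0.
Qed.

Lemma face_gen_convex (C : numClosedFieldType) N (K X : fset C N) : convex (face_gen K X).
Proof.
move=> x y t Fx Fy t01 F faceF XF; have [_ [cF _]] := faceF.
by apply: cF => //; [apply: Fx | apply: Fy].
Qed.

Lemma face_gen_gen (C : numClosedFieldType) N (K X : fset C N) : fsubset X (face_gen K X).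
Proof. by move=> w Xw F _; apply. Qed.

Lemma face_gen_mono (C : numClosedFieldType) N (K X Y : fset C N) :
  fsubset X Y -> fsubset (face_gen K X) (face_gen K Y).
Proof. by move=> XY w Xw F faceF YF; apply: Xw => // v /XY /YF. Qed.

(** * Product vectors and separable states *)

Lemma frob_tens (C : numClosedFieldType) r s (x : 'cV[C]_r) (y : 'cV[C]_s) :
  frob (tens x y) = frob x * frob y.
Proof.
rewrite !frobE !big_ord1 (reindex _ (curry_mxvec_bij r s)) /=.
rewrite mulr_suml; under [RHS]eq_bigr do rewrite mulr_sumr.
rewrite pair_bigA; apply: eq_bigr => -[i j] _ /=.
by rewrite mxE mxvecE mxE big_ord1 mxE normrM exprMn.
Qed.

Lemma unit_tens (C : numClosedFieldType) r s (x : 'cV[C]_r) (y : 'cV[C]_s) :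
  unit_vec x -> unit_vec y -> unit_vec (tens x y).
Proof.
by move=> /unit_vec_frob x1 /unit_vec_frob y1; apply/unit_vec_frob; rewrite frob_tens x1 y1 mulr1.
Qed.

Lemma tensZl (C : numClosedFieldType) r s a (x : 'cV[C]_r) (y : 'cV[C]_s) :
  tens (a *: x) y = a *: tens x y.
Proof. by rewrite /tens -scalemxAl !linearZ. Qed.

Lemma tensZr (C : numClosedFieldType) r s a (x : 'cV[C]_r) (y : 'cV[C]_s) :
  tens x (a *: y) = a *: tens x y.
Proof. by rewrite /tens linearZ -scalemxAr !linearZ. Qed.

Lemma tens_sumr (C : numClosedFieldType) r s p (x : 'cV[C]_r) (y : 'I_p -> 'cV[C]_s) :
  tens x (\sum_j y j) = \sum_j tens x (y j).
Proof. by rewrite /tens !(linear_sum, mulmx_sumr). Qed.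

Lemma unit_vstate (C : numClosedFieldType) N (z : 'cV[C]_N) :
  unit_vec z -> is_state (vstate z).
Proof. by rewrite vstate_gram => /unit_vec_frob; apply: gram_state_is_state. Qed.

Lemma separable_state (C : numClosedFieldType) r s :
  fsubset (separable C r s) (state_space C (r * s)).
Proof.
move=> _ [k [lam [x [y [wt [xy1 ->]]]]]].
apply: convex_comb_in => // [u v t|i]; first exact: is_state_segment.
by have [x1 y1] := xy1 i; apply/unit_vstate/unit_tens.
Qed.

Lemma separable_convex (C : numClosedFieldType) r s : convex (separable C r s).
Proof.
move=> w w' t [k [lam [x [y [[lam0 lam1] [xy1 ->]]]]]].
move=> [k' [lam' [x' [y' [[lam0' lam1'] [xy1' ->]]]]]] /andP[t0 t1].
exists (k + k')%N.
exists (fun i => match split i with inl a => t * lam a | inr b => (1 - t) * lam' b end).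
exists (fun i => match split i with inl a => x a | inr b => x' b end).
exists (fun i => match split i with inl a => y a | inr b => y' b end).
have spl a : split (lshift k' a) = inl a := unsplitK (inl a).
have spr b : split (rshift k b) = inr b := unsplitK (inr b).
split; first split.
- by move=> i; case: splitP => a _; rewrite mulr_ge0 // subr_ge0.
- rewrite big_split_ord /=.
  under eq_bigr do rewrite spl.
  under [X in _ + X]eq_bigr do rewrite spr.
  by rewrite -!mulr_sumr lam1 lam1'; ring.
split; first by move=> i; case: splitP => a _.
apply: functional_extensionality => A.
rewrite /segment /convex_comb big_split_ord /= !mulr_sumr.
by congr (_ + _); apply: eq_bigr => i _; rewrite ?spl ?spr mulrA.
Qed.

(** * Lines and spans of subfamilies *)

Lemma same_line_scale (C : numClosedFieldType) r (x y : 'cV[C]_r) :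
  same_line x y -> exists a, x = a *: y.
Proof.
by move=> /andP[/sub_rVP[a xy] _]; exists a; apply: trmx_inj; rewrite xy linearZ.
Qed.

Lemma scale_same_line (C : numClosedFieldType) r a b (x y : 'cV[C]_r) :
  a *: x = b *: y -> a != 0 -> b != 0 -> same_line x y.
Proof.
move=> xy a0 b0; apply/eqmxP.
apply: eqmx_trans (eqmx_sym (eqmx_scale _ a0)) (eqmx_trans _ (eqmx_scale _ b0)).
by rewrite -!linearZ xy; apply: eqmx_refl.
Qed.

Lemma same_line_sym (C : numClosedFieldType) r (x y : 'cV[C]_r) :
  same_line x y = same_line y x.
Proof. by rewrite /same_line andbC. Qed.

Lemma same_line_trans (C : numClosedFieldType) r (x y z : 'cV[C]_r) :
  same_line x y -> same_line y z -> same_line x z.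
Proof. by move=> /eqmxP xy /eqmxP yz; apply/eqmxP/(eqmx_trans xy). Qed.

Lemma same_line_refl (C : numClosedFieldType) r (x : 'cV[C]_r) : same_line x x.
Proof. exact/eqmxP/eqmx_refl. Qed.

(** Rows outside [J] are set to zero instead of being dropped, so that all subfamilies share one
    coefficient space and restriction to [J] is a diagonal factor. *)
Definition span_mx (C : numClosedFieldType) N p (J : pred 'I_p) (u : 'I_p -> 'cV[C]_N) :
  'M[C]_(p, N) := \matrix_(j < p) (if J j then (u j)^T else 0).

Lemma span_mx_mem (C : numClosedFieldType) N p (J : pred 'I_p) (u : 'I_p -> 'cV[C]_N) j :
  J j -> ((u j)^T <= span_mx J u)%MS.
Proof. by move=> Jj; have := row_sub j (span_mx J u); rewrite rowK Jj. Qed.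

Lemma span_mx_diag (C : numClosedFieldType) N p (J : pred 'I_p) (u : 'I_p -> 'cV[C]_N) :
  span_mx J u = diag_mx (\row_j (J j)%:R) *m span_mx xpredT u.
Proof.
apply/row_matrixP => j; rewrite row_mul rowK row_diag_mx mxE -scalemxAl -rowE rowK.
by case: (J j); rewrite ?scale1r ?scale0r.
Qed.

Lemma span_mx_sub (C : numClosedFieldType) N p (J : pred 'I_p) (u v : 'I_p -> 'cV[C]_N) :
  (forall j, J j -> exists a, u j = a *: v j) -> (span_mx J u <= span_mx J v)%MS.
Proof.
move=> uv; apply/row_subP => j; rewrite rowK; case: ifP => [Jj|_]; last exact: sub0mx.
by have [a ->] := uv j Jj; rewrite linearZ scalemx_sub // span_mx_mem.
Qed.

(** * Supported states as generated faces of the separable states *)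

Lemma supported_vstate (C : numClosedFieldType) N r (M : 'M[C]_(r, N)) (z : 'cV[C]_N) :
  unit_vec z -> (z^T <= M)%MS -> supported M (vstate z).
Proof. by move=> /unit_vec_frob z1 zM; exists 1, z; rewrite vstate_gram. Qed.

(** Each column of [Z] is a product [tens x0 g], and the state is the sum of the functionals of the
    columns. Normalising [g] turns its squared length into the weight. *)
Lemma supported_separable (C : numClosedFieldType) r s p (M : 'M[C]_(p, r * s))
    (x0 : 'cV[C]_r) (y0 : 'cV[C]_s) :
  unit_vec x0 -> unit_vec y0 ->
  (forall z : 'cV_(r * s), (z^T <= M)%MS -> exists g : 'cV_s, z = tens x0 g) ->
  fsubset (supported M) (separable C r s).
Proof.
move=> x1 y1 prodM _ [k [Z [ZM Z1 ->]]].
have /fin_all_exists[g Zg] i : exists g : 'cV_s, col i Z = tens x0 g.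
  by apply: prodM; rewrite tr_col; apply: submx_trans ZM; apply: row_sub.
exists k, (fun i => frob (g i)), (fun _ => x0).
(* [y0] is a filler for zero columns, which have weight zero. *)
exists (fun i => if g i == 0 then y0 else (sqrtC (frob (g i)))^-1 *: g i).
have frobg i : frob (col i Z) = frob (g i).
  by rewrite Zg frob_tens (proj1 (unit_vec_frob _) x1) mul1r.
split; first split=> [i|]; first exact: frob_ge0.
  by rewrite -Z1 frob_col; apply: eq_bigr.
have sq_frob (h : 'cV[C]_s) : `|(sqrtC (frob h))^-1| ^+ 2 = (frob h)^-1.
  by rewrite ger0_norm ?invr_ge0 ?sqrtC_ge0 ?frob_ge0 // exprVn sqrtCK.
have frob_neq0 (h : 'cV[C]_s) : h != 0 -> frob h != 0.
  by apply: contra_neq; apply: frob_eq0.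
split=> [i|].
  split=> //; case: eqVneq => // gi; apply/unit_vec_frob.
  by rewrite frobZ sq_frob mulVf ?frob_neq0.
apply: functional_extensionality => A; rewrite gram_state_col; apply: eq_bigr => i _.
rewrite vstate_gram Zg; case: eqVneq => [->|gi].
  by rewrite frob0 mul0r -[0 : 'cV_s](scale0r 0) tensZr gram_stateZ normr0 expr0n mul0r.
by rewrite tensZr gram_stateZ sq_frob mulrA divff ?mul1r ?frob_neq0.
Qed.

(* The normalised sum of the generating vector states has full rank on the span,
   so it dominates a positive multiple of any state supported there; the
   remainder is supported there too, hence lies in [S]. *)
Lemma face_gen_supported (C : numClosedFieldType) N p (S : fset C N) (J : pred 'I_p)
    (u : 'I_p -> 'cV[C]_N) j0 :
  J j0 -> (forall j, unit_vec (u j)) -> fsubset S (state_space C N) ->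
  fsubset (supported (span_mx J u)) S ->
  face_gen S (fun w => exists j, J j /\ w = vstate (u j)) = supported (span_mx J u).
Proof.
move=> Jj0 u1 SK supS; set M := span_mx J u.
apply: functional_extensionality => w; apply: propositional_extensionality.
have [_ [cM fM]] := supported_face M.
split=> [|[k [Z [/submxP[Y ZY] Z1 wZ]]] G faceG genG].
  (* As a face of the state space that lies in [S], [supported M] is also a face of [S]. *)
  apply=> [|_ [j [Jj ->]]]; last by apply: supported_vstate; rewrite ?span_mx_mem.
  split=> //; split=> // x y t /SK Kx /SK Ky; exact: fM.
have [_ [cG fG]] := faceG.
have colM j : col j M^T = if J j then u j else 0.
  by rewrite -tr_row rowK; case: ifP; rewrite ?trmxK ?trmx0.
pose c := frob M^T.
have c0 : 0 < c.
  rewrite lt_def frob_ge0 andbT; apply/eqP => /frob_eq0 /(congr1 (col j0)).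
  rewrite colM Jj0 col0; apply/eqP; exact: unit_vec_neq0.
pose sg : Func C N := fun A => c^-1 * gram_state M^T A.
have Gsg : G sg.
  (* Indices outside [J] have weight zero; [j0] only keeps their points among the generators. *)
  have -> : sg = convex_comb (fun j => frob (col j M^T) / c)
                   (fun j => vstate (u (if J j then j else j0))).
    apply: functional_extensionality => A.
    rewrite /sg gram_state_col mulr_sumr; apply: eq_bigr => j _; rewrite colM vstate_gram.
    case: (J j); first by rewrite (proj1 (unit_vec_frob _) (u1 _)) mul1r.
    by rewrite frob0 !mul0r /gram_state mulmx0 mxtrace0 mulr0.
  apply: convex_comb_in => //; last first.
    by move=> j; apply: genG; case: ifP => Jj; [exists j | exists j0].
  split=> [j|]; first by rewrite divr_ge0 ?frob_ge0 // ltW.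
  by rewrite -mulr_suml -frob_col divff // gt_eqF.
have ZM : (Z^T <= M)%MS by rewrite ZY submxMl.
have Zfac : Z = M^T *m Y^T by rewrite -[Z]trmxK ZY trmx_mul.
(* On positive elements [w <= b * c * sg], so [eps * b * c <= 1] makes [sg - eps * w] positive. The
   summand [1 + 1] forces [eps < 1], so that the remainder can be normalised. *)
pose b := frob Y^T; pose eps := (1 + 1 + c * b)^-1.
have cb : 0 <= c * b by rewrite mulr_ge0 ?frob_ge0.
have lt1 : 1 < 1 + 1 + c * b by rewrite -addrA ltrDl ltr_wpDr ?ltr01.
have den0 : 0 < 1 + 1 + c * b := lt_trans ltr01 lt1.
have eps0 : 0 < eps by rewrite invr_gt0.
have eps1 : eps < 1 by rewrite invf_lt1.
have d0 : 0 < 1 - eps by rewrite subr_gt0.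
have dn0 := lt0r_neq0 d0.
(* Solves [sg = eps * w + (1 - eps) * tau]; the face property at [sg] then yields [w]. *)
pose tau : Func C N := fun A => (1 - eps)^-1 * (sg A - eps * w A).
have stw : is_state w by rewrite wZ; apply: gram_state_is_state.
have [lw [pw w1]] := stw.
have dM : defect M (gram_state M^T) = 0.
  by apply/eqP; rewrite gram_defect trmxK.
have tauM : supported M tau.
  apply/supportedP; split; last first.
    rewrite /defect /tau /sg -!/(defect M _) dM wZ.
    have /eqP -> : defect M (gram_state Z) == 0 by rewrite gram_defect.
    by rewrite !mulr0 subr0 mulr0.
  split; first by move=> a A B; rewrite /tau /sg gram_stateZD lw; ring.
  split; last by rewrite /tau /sg gram_state1 -/c w1 mulVf ?gt_eqF // mulr1 mulVf.
  move=> A; apply: mulr_ge0; first by rewrite invr_ge0 ltW.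
  rewrite subr_ge0 /sg wZ !gram_state_sq.
  have h : frob (A *m Z) <= b * frob (A *m M^T).
    by rewrite Zfac mulmxA mulrC frobM_le.
  apply: le_trans (_ : eps * (b * frob (A *m M^T)) <= _).
    by rewrite ler_pM2l.
  rewrite mulrA ler_wpM2r ?frob_ge0 // -(ler_pM2l c0) divff ?gt_eqF //.
  rewrite /eps mulrCA mulrC ler_pdivrMr // mul1r lerDr addr_ge0 ?ler01 //.
have sgE : sg = segment eps w tau.
  by apply: functional_extensionality => A; rewrite /segment /tau mulVKf //; ring.
have t01 : 0 < eps < 1 by rewrite eps0.
have wS : S w by apply: supS; exists k, Z.
by have [] := fG w tau eps wS (supS _ tauM) t01; rewrite // -sgE.
Qed.

(** * Product vectors in the span of the given ones *)

Lemma tens_comb (C : numClosedFieldType) r s p (e : 'I_p -> 'cV[C]_r)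
    (f : 'I_p -> 'cV[C]_s) (c : 'rV[C]_p) :
  vec_mx (c *m span_mx xpredT (fun j => tens (e j) (f j))) =
  (\matrix_j (e j)^T)^T *m diag_mx c *m \matrix_j (f j)^T.
Proof.
apply/matrixP => i j; rewrite mul_mx_diag !mxE; apply: eq_bigr => k _.
by rewrite !mxE mxvecE !mxE big_ord1 !mxE mulrA [c 0 k * _]mulrC.
Qed.

(** Read as matrices, the hypothesis is [x y^T = E^T diag(c) Fm], where [E] has the rows [(e j)^T].
    By freeness [pinvmx Fm] is a right inverse of [Fm]; multiplying by it and comparing columns
    gives the relations. *)
Lemma tens_comb_dual (C : numClosedFieldType) r s p (e : 'I_p -> 'cV[C]_r)
    (f : 'I_p -> 'cV[C]_s) (c : 'rV[C]_p) (x : 'cV[C]_r) (y : 'cV[C]_s) :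
  row_free (\matrix_j (f j)^T) ->
  (tens x y)^T = c *m span_mx xpredT (fun j => tens (e j) (f j)) ->
  exists d : 'I_p -> C, forall j, d j *: x = c 0 j *: e j.
Proof.
set Fm := \matrix_j (f j)^T => /mulmxVp FV xyc.
exists (fun j => (y^T *m pinvmx Fm) 0 j) => j.
have := congr1 vec_mx xyc; rewrite tens_comb trmxK mxvecK -/Fm.
move=> /(congr1 (fun B => B *m pinvmx Fm)).
rewrite -!mulmxA FV mulmx1 mul_mx_diag => /matrixP h.
by apply/matrixP => i k; have := h i j; rewrite !ord1 !mxE big_ord1 !mxE mulrC [_ * c 0 j]mulrC.
Qed.

(** The zero vector is the product of two zero vectors, so a vanishing combination gives
    [c 0 j *: e j = 0] for each [j]. *)
Lemma tens_free (C : numClosedFieldType) r s p (e : 'I_p -> 'cV[C]_r)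
    (f : 'I_p -> 'cV[C]_s) :
  (forall j, unit_vec (e j)) -> row_free (\matrix_j (f j)^T) ->
  row_free (span_mx xpredT (fun j => tens (e j) (f j))).
Proof.
move=> e1 ff; apply: inj_row_free => c c0.
have c0' : (tens (0 : 'cV[C]_r) (0 : 'cV[C]_s))^T =
    c *m span_mx xpredT (fun j => tens (e j) (f j)).
  by rewrite c0 /tens mul0mx linear0 !trmx0.
have [d dc] := tens_comb_dual ff c0'; apply/rowP => j; rewrite mxE.
have /eqP := dc j; rewrite scaler0 eq_sym scaler_eq0.
by rewrite (negbTE (unit_vec_neq0 (e1 j))) orbF => /eqP.
Qed.

(* Pairing [x (x) y = sum_j c_j e_j (x) f_j] with the dual basis of [f] forces
   every [e_j] with [c_j <> 0] onto the line of [x]. *)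
Lemma tens_in_span (C : numClosedFieldType) r s p (e : 'I_p -> 'cV[C]_r)
    (f : 'I_p -> 'cV[C]_s) (x : 'cV[C]_r) (y : 'cV[C]_s) :
  let u j := tens (e j) (f j) in
  (forall j, unit_vec (e j)) -> row_free (\matrix_j (f j)^T) ->
  unit_vec x -> unit_vec y -> ((tens x y)^T <= span_mx xpredT u)%MS ->
  exists j, ((tens x y)^T <= span_mx (fun k => same_line (e k) (e j)) u)%MS.
Proof.
move=> u e1 ff x1 y1 /submxP[c xyc].
have [d dc] := tens_comb_dual ff xyc.
have xl j : c 0 j != 0 -> same_line (e j) x.
  move=> cj; apply: (scale_same_line (esym (dc j)) cj).
  apply: contra_eq_neq (dc j) => ->; rewrite scale0r eq_sym scaler_eq0.
  by rewrite (negbTE cj) unit_vec_neq0.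
have [c0|/rV0Pn[j cj]] := eqVneq c 0.
  have := unit_vec_neq0 (unit_tens x1 y1).
  by rewrite -trmx_eq0 xyc c0 mul0mx eqxx.
exists j; rewrite xyc mulmx_sum_row summx_sub // => k _.
have [->|ck] := eqVneq (c 0 k) 0; first by rewrite scale0r sub0mx.
rewrite scalemx_sub // rowK.
apply: (@span_mx_mem _ _ _ (fun k => same_line (e k) (e j)) u k).
by apply: same_line_trans (xl k ck) _; rewrite same_line_sym xl.
Qed.

(** [pinvmx] of the full family is a right inverse, so only the two diagonal selectors remain. For
    fixed [J'], the last two factors form an oblique projection that keeps the vectors in [J'] and
    kills the other members of the family. *)
Lemma span_mx_projection (C : numClosedFieldType) N p (J J' : pred 'I_p)
    (u : 'I_p -> 'cV[C]_N) :
  row_free (span_mx xpredT u) ->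
  span_mx J u *m pinvmx (span_mx xpredT u) *m span_mx J' u
  = span_mx (fun j => J j && J' j) u.
Proof.
move=> /mulmxVp uV.
rewrite (span_mx_diag J) (span_mx_diag J') (span_mx_diag (fun j => J j && J' j)).
rewrite -[_ *m pinvmx _]mulmxA uV mulmx1 mulmxA mulmx_diag.
congr (diag_mx _ *m _); apply/rowP => j; rewrite !mxE.
by case: (J j); rewrite ?mul1r ?mul0r.
Qed.

(** * Direct convex sums *)

(** Evaluation at [T i A] isolates the i-th term. At [A = 1] it gives the weight, whose positivity
    determines [I]; dividing by it recovers [w i]. *)
Lemma dcs_expr_unique (C : numClosedFieldType) N q (Cs : 'I_q -> fset C N)
    (T : 'I_q -> 'M[C]_N -> 'M[C]_N) :
  (forall i w, Cs i w -> is_state w) ->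
  (forall i j w A, Cs j w -> w (T i A) = if i == j then w A else 0) ->
  forall I lam w I' lam' w', dcs_valid Cs I lam w -> dcs_valid Cs I' lam' w' ->
  dcs_expr I lam w = dcs_expr I' lam' w' ->
  I = I' /\ forall i, i \in I -> lam i = lam' i /\ w i = w' i.
Proof.
move=> stC TC I lam w I' lam' w' val val' eqx.
have component I1 l1 w1 i A : dcs_valid Cs I1 l1 w1 ->
    dcs_expr I1 l1 w1 (T i A) = if i \in I1 then l1 i * w1 i A else 0.
  move=> [v1 _]; rewrite /dcs_expr; case: ifP => iI.
    rewrite (bigD1 i) //= (TC i i) ?eqxx; last by case: (v1 i iI).
    rewrite big1 ?addr0 // => j /andP[jI ji].
    by rewrite (TC i j) 1?eq_sym ?(negbTE ji) ?mulr0 //; case: (v1 j jI).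
  rewrite big1 // => j jI; rewrite (TC i j); last by case: (v1 j jI).
  by case: eqVneq => [ij|_]; rewrite ?mulr0 //; rewrite ij jI in iI.
have weight I1 l1 w1 i : dcs_valid Cs I1 l1 w1 ->
    dcs_expr I1 l1 w1 (T i 1%:M) = if i \in I1 then l1 i else 0.
  move=> v1; rewrite component //; case: ifP => // iI.
  by have [_ /stC[_ [_ ->]]] := proj1 v1 i iI; rewrite mulr1.
have eqI : I = I'.
  apply/setP => i; have := weight _ _ _ i val; rewrite eqx (weight _ _ _ _ val').
  case: (boolP (i \in I)) => iI; case: (boolP (i \in I')) => iI' // h.
    by have [] := proj1 val i iI; rewrite -h ltxx.
  by have [] := proj1 val' i iI'; rewrite h ltxx.
split=> // i iI; have iI' : i \in I' by rewrite -eqI.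
have eql : lam i = lam' i.
  by have := weight _ _ _ i val; rewrite eqx (weight _ _ _ _ val') iI iI'.
split=> //; apply: functional_extensionality => A.
have := component _ _ _ i A val; rewrite eqx (component _ _ _ _ _ val') iI iI' -eql.
have [l0 _] := proj1 val i iI.
by move/(mulfI (lt0r_neq0 l0)).
Qed.

(** The points are grouped by a chosen set [Cs i] containing them, and each group is replaced by its
    barycentre, which convexity keeps in [Cs i]. *)
Lemma dcs_exists (C : numClosedFieldType) N q k (Cs : 'I_q -> fset C N)
    (lam : 'I_k -> C) (v : 'I_k -> Func C N) :
  (forall i, convex (Cs i)) -> (forall i, exists w, Cs i w) -> cc_weights lam ->
  (forall a, lam a != 0 -> exists i, Cs i (v a)) ->
  exists I l w, dcs_valid Cs I l w /\ convex_comb lam v = dcs_expr I l w.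
Proof.
move=> cC neC [lam0 lam1] inC.
have [a0 la0] : exists a, lam a != 0.
  apply/existsP; apply: contraT; rewrite negb_exists => /forallP h.
  have /eqP := lam1; rewrite big1 ?[0 == 1]eq_sym ?oner_eq0 // => a _.
  by apply/eqP; have := h a; rewrite negbK.
have [i0 _] := inC a0 la0.
have /fin_all_exists[cls clsP] a : exists i, lam a != 0 -> Cs i (v a).
  have [_|/inC[i Ci]] := eqVneq (lam a) 0; first by exists i0.
  by exists i.
have /fin_all_exists[pt ptP] := neC.
pose L i := \sum_(a | cls a == i) lam a.
have L0 i : 0 <= L i by apply: sumr_ge0.
(* The filler [pt i] occurs only with coefficient [ll i a = 0]. *)
pose vv i a := if (cls a == i) && (lam a != 0) then v a else pt i.
pose ll i a := if cls a == i then lam a / L i else 0.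
(* Groups of total weight zero are left out, since the weights on [I] must be positive. *)
exists [set i | L i != 0], L, (fun i => convex_comb (ll i) (vv i)).
have sumL (F : 'I_q -> C) : (forall i, L i = 0 -> F i = 0) ->
    \sum_(i in [set i | L i != 0]) F i = \sum_i F i.
  move=> F0; rewrite [RHS](bigID (fun i => i \in [set i | L i != 0])) /=.
  rewrite [X in _ + X]big1 ?addr0 // => i; rewrite inE negbK => /eqP; exact: F0.
have null i a : L i = 0 -> cls a == i -> lam a = 0.
  move=> /eqP; rewrite psumr_eq0 // => /allP/(_ a (mem_index_enum a)) /=.
  by move=> h ca; move: h; rewrite ca => /eqP.
split.
  split=> [i|]; last by rewrite sumL // -lam1 [RHS](partition_big cls xpredT).
  rewrite inE => Li; split; first by rewrite lt_def Li L0.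
  apply: convex_comb_in => // [|a].
    split=> [a|]; first by rewrite /ll; case: ifP => // _; rewrite divr_ge0.
    by rewrite /ll -big_mkcond -mulr_suml divff.
  by rewrite /vv; case: ifP => // /andP[/eqP <-]; apply: clsP.
apply: functional_extensionality => A; rewrite /dcs_expr sumL; last first.
  by move=> i ->; rewrite mul0r.
rewrite /convex_comb [LHS](partition_big cls xpredT) //=.
apply: eq_bigr => i _; rewrite mulr_sumr big_mkcond /=; apply: eq_bigr => a _.
rewrite /ll /vv; case: ifP => ca; last by rewrite mul0r mulr0.
have [la|la] := eqVneq (lam a) 0; first by rewrite la !mul0r mulr0.
have Li : L i != 0 by apply: contra_neq la => /null; apply.
by rewrite /= mulrA mulrCA divff // mulr1.
Qed.

(** * The spaces [L_i] and separable states of zero defect *)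

Lemma eq_span_mx (C : numClosedFieldType) N p (J J' : pred 'I_p) (u : 'I_p -> 'cV[C]_N) :
  J =1 J' -> span_mx J u = span_mx J' u.
Proof. by move=> eqJ; apply/row_matrixP => j; rewrite !rowK eqJ. Qed.

Lemma L_mx_span (C : numClosedFieldType) r s p (e : 'I_p -> 'cV[C]_r)
    (f : 'I_p -> 'cV[C]_s) (e0 : 'cV[C]_r) :
  (L_mx e f e0 :=: span_mx (fun j => same_line (e j) e0) (fun j => tens (e j) (f j)))%MS.
Proof.
apply/eqmxP/andP; split; apply: span_mx_sub => j.
  by rewrite same_line_sym => /same_line_scale[a ->]; exists a; rewrite tensZl.
by move=> /same_line_scale[a ->]; exists a; rewrite tensZl.
Qed.

Lemma L_mx_tens (C : numClosedFieldType) r s p (e : 'I_p -> 'cV[C]_r)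
    (f : 'I_p -> 'cV[C]_s) (e0 : 'cV[C]_r) (z : 'cV[C]_(r * s)) :
  (z^T <= L_mx e f e0)%MS -> exists g, z = tens e0 g.
Proof.
move=> /submxP[c zc].
exists (\sum_j (c 0 j * (same_line (e j) e0)%:R) *: f j).
apply: trmx_inj; rewrite zc mulmx_sum_row tens_sumr linear_sum; apply: eq_bigr => j _ /=.
rewrite rowK tensZr linearZ /= -scalerA; congr (_ *: _).
by case: same_line; rewrite ?scale1r ?scale0r.
Qed.

(** Every column of [Z] is a multiple of [z], and the squared moduli of the factors sum to 1. *)
Lemma supported_line (C : numClosedFieldType) N r (M : 'M[C]_(r, N)) (z : 'cV[C]_N) w :
  unit_vec z -> (M <= z^T)%MS -> supported M w -> w = vstate z.
Proof.
move=> /unit_vec_frob z1 Mz [k [Z [ZM Z1 ->]]].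
have /fin_all_exists[a Za] i : exists a, col i Z = a *: z.
  have /sub_rVP[a Za] : ((col i Z)^T <= z^T)%MS.
    by apply: submx_trans Mz; apply: submx_trans ZM; rewrite tr_col row_sub.
  by exists a; apply: trmx_inj; rewrite Za linearZ.
have a1 : \sum_i `|a i| ^+ 2 = 1.
  by rewrite -Z1 frob_col; apply: eq_bigr => i _; rewrite Za frobZ z1 mulr1.
apply: functional_extensionality => A; rewrite vstate_gram gram_state_col.
by under eq_bigr do rewrite Za gram_stateZ; rewrite -mulr_suml a1 mul1r.
Qed.

Lemma defect_comb (C : numClosedFieldType) N r k (M : 'M[C]_(r, N)) (lam : 'I_k -> C)
    (v : 'I_k -> Func C N) :
  defect M (convex_comb lam v) = \sum_i lam i * defect M (v i).
Proof. by []. Qed.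

Lemma separable_vstate (C : numClosedFieldType) r s (x : 'cV[C]_r) (y : 'cV[C]_s) :
  unit_vec x -> unit_vec y -> separable C r s (vstate (tens x y)).
Proof.
move=> x1 y1; exists 1, (fun _ => 1), (fun _ => x), (fun _ => y).
split; first by split=> [_|]; rewrite ?ler01 // big_ord1.
split=> //; apply: functional_extensionality => A.
by rewrite /convex_comb big_ord1 mul1r.
Qed.

(** Bounds [F] from above. On the span of all generators supported states may be entangled, so
    separability is kept as a separate condition. *)
Lemma separable_defect_face (C : numClosedFieldType) r s p (M : 'M[C]_(p, r * s)) :
  is_face (separable C r s) (fun w => separable C r s w /\ defect M w = 0).
Proof.
split; first by move=> w [].
split=> [x y t [Sx dx] [Sy dy] t01|x y t Sx Sy t01 [_ d0]].
  by split; [apply: separable_convex | apply: defect_segment0].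
have [dx dy] := defect_segment (separable_state Sx) (separable_state Sy) t01 d0.
by split.
Qed.

(** * The faces [F_i] and their direct convex sum *)

Theorem mainTheorem4 (C : numClosedFieldType) (m n p q : nat)
  (e : 'I_p -> 'cV[C]_m) (f : 'I_p -> 'cV[C]_n) (hqp : (q <= p)%N) :
  (forall j, unit_vec (e j)) ->
  (forall j, unit_vec (f j)) ->
  row_free (\matrix_(j < p) (f j)^T) ->
  (forall i j : 'I_q,
     same_line (e (widen_ord hqp i)) (e (widen_ord hqp j)) -> i = j) ->
  (forall j : 'I_p, (q <= j)%N ->
     exists i : 'I_q, same_line (e j) (e (widen_ord hqp i))) ->
  let K := state_space C (m * n) in
  let S := separable C m n in
  let Fi := fun i : 'I_q =>
    face_gen S (fun w => exists j : 'I_p,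
      same_line (e j) (e (widen_ord hqp i)) /\ w = vstate (tens (e j) (f j))) in
  let F := face_gen S (fun w => exists j : 'I_p, w = vstate (tens (e j) (f j))) in
  (forall i : 'I_q,
     is_face K (Fi i) /\
     affinely_isomorphic (Fi i)
       (state_space C (\rank (L_mx e f (e (widen_ord hqp i)))))) /\
  direct_convex_sum F Fi /\
  ((forall j1 j2 : 'I_p, same_line (e j1) (e j2) -> j1 = j2) ->
     (forall w, F w <->
        convex_hull (fun v => exists j : 'I_p, v = vstate (tens (e j) (f j))) w) /\
     simplex F).
Proof.
move=> e1 f1 ff distinct cover K S Fi F.
pose u j := tens (e j) (f j).
have u1 j : unit_vec (u j) by apply: unit_tens.
pose J (i : 'I_q) : pred 'I_p := fun j => same_line (e j) (e (widen_ord hqp i)).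
pose M := span_mx xpredT u.
have FiE i : Fi i = supported (span_mx (J i) u).
  apply: (@face_gen_supported _ _ _ S (J i) u (widen_ord hqp i)) => //.
  - exact: same_line_refl.
  - exact: separable_state.
  - apply: supported_separable (e1 (widen_ord hqp i)) (f1 (widen_ord hqp i)) _ => z.
    by rewrite -L_mx_span; apply: L_mx_tens.
have J_cover j : exists i, J i j.
  have [/cover //|ltjq] := leqP q j; exists (Ordinal ltjq).
  by rewrite /J (_ : widen_ord _ _ = j) ?same_line_refl //; apply: val_inj.
have J_disj i i' j : J i j -> J i' j -> i = i'.
  move=> Jij Ji'j; apply: distinct; apply: same_line_trans Ji'j.
  by rewrite same_line_sym.
have F_sep w : F w -> S w /\ defect M w = 0.
  move=> Fw; apply: (Fw _ (separable_defect_face M)) => _ [j ->].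
  have uM : supported M (vstate (u j)) by apply: supported_vstate; rewrite ?span_mx_mem.
  by split; [apply: separable_vstate | case/supportedP: uM].
have dcs : direct_convex_sum F Fi.
  split=> [i|x Fx].
    split; last exact: face_gen_convex.
    by apply: face_gen_mono => w [j [_ ->]]; exists j.
  split; last first.
    move=> I lam w I' lam' w' val val' xw xw'.
    (* The oblique projection onto [L_i], transposed to act on columns; it fixes factors supported
       on [L_i] and kills those supported on another [L_j]. *)
    pose R i := (pinvmx M *m span_mx (J i) u)^T.
    apply: (@dcs_expr_unique _ _ _ Fi (fun i A => adjmx (R i) *m A *m R i)) val val' _.
    - by move=> i v; rewrite FiE => /supportedP[].
    - move=> i j v A; rewrite FiE => -[k [Z [/submxP[Y ZY] _ ->]]].
      rewrite gram_state_compress.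
      have RZ : (R i *m Z)^T = Y *m span_mx (fun l => J j l && J i l) u.
        have <- := span_mx_projection (J j) (J i) (tens_free e1 ff).
        by rewrite trmx_mul ZY trmxK -[LHS]mulmxA [_ *m (pinvmx M *m _)]mulmxA.
      have [ij|nij] := eqVneq i j.
        suff -> : R i *m Z = Z by [].
        apply: trmx_inj; rewrite RZ ZY ij; congr (_ *m _).
        by apply: eq_span_mx => l; rewrite andbb.
      suff -> : R i *m Z = 0 by rewrite /gram_state mulmx0 mxtrace0.
      apply: trmx_inj; rewrite RZ trmx0 (_ : span_mx _ _ = 0) ?mulmx0 //.
      apply/row_matrixP => l; rewrite rowK row0; case: ifP => // /andP[Jj Ji].
      by rewrite (J_disj _ _ _ Ji Jj) eqxx in nij.
    - by rewrite -xw -xw'.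
  have [[k [lam [a [b [wt [ab1 xE]]]]]] dx] := F_sep x Fx.
  have [lam0 _] := wt.
  rewrite xE; apply: dcs_exists wt _.
  - by move=> i; apply: face_gen_convex.
  - by move=> i; exists (vstate (u (widen_ord hqp i))); apply: face_gen_gen;
      exists (widen_ord hqp i); split=> //; apply: same_line_refl.
  move=> l ll; have [al bl] := ab1 l.
  (* The defect of [x] is a sum of nonnegative terms equal to zero, so each product vector of
     nonzero weight lies in the span. *)
  have abM : ((tens (a l) (b l))^T <= M)%MS.
    move: dx; rewrite xE defect_comb => /eqP.
    rewrite psumr_eq0 => [|l' _]; last first.
      have [al' bl'] := ab1 l'; rewrite mulr_ge0 //.
      exact/defect_ge0/unit_vstate/unit_tens.
    move=> /allP/(_ l (mem_index_enum l)) /=; rewrite mulf_eq0 (negbTE ll) /=.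
    by rewrite vstate_gram gram_defect.
  have [j abj] := tens_in_span e1 ff al bl abM.
  have [i Jij] := J_cover j; exists i; rewrite FiE; apply: supported_vstate.
    exact: unit_tens.
  suff <- : span_mx (fun l0 => same_line (e l0) (e j)) u = span_mx (J i) u by [].
  apply: eq_span_mx => l'; apply/idP/idP => h; first exact: same_line_trans h Jij.
  by apply: same_line_trans h _; rewrite same_line_sym.
split=> [i|].
  rewrite FiE; split; first exact: supported_face.
  by rewrite -(supported_eqmx (L_mx_span _ _ _)); apply: supported_isomorphic.
split=> // inj_e.
(* With all lines distinct each [L_i] is one-dimensional and supports a single state. *)
have FiP : Fi = fun i w => w = vstate (u (widen_ord hqp i)).
  apply: functional_extensionality => i; apply: functional_extensionality => w.
  apply: propositional_extensionality; rewrite FiE; split=> [|->].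
    apply: supported_line => //; apply/row_subP => j; rewrite rowK.
    case: ifP => [/inj_e ->|_]; [exact: submx_refl | exact: sub0mx].
  by apply: supported_vstate => //; apply: span_mx_mem; apply: same_line_refl.
split; last by exists q, (fun i => vstate (u (widen_ord hqp i))); rewrite -FiP.
move=> x; split=> [Fx|[k [lam [v [wt [Xv ->]]]]]]; last first.
  apply: convex_comb_in wt _ => [|i]; first exact: face_gen_convex.
  exact: face_gen_gen.
have [[I [lam [w [[val sum1] ->]]]] _] := proj2 dcs x Fx.
(* The weights are extended by zero outside [I]. *)
exists q, (fun i => if i \in I then lam i else 0), (fun i => vstate (u (widen_ord hqp i))).
split; first split=> [i|].
- by case: ifP => // /val[/ltW].
- by rewrite -big_mkcond.
split=> [i|]; first by exists (widen_ord hqp i).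
apply: functional_extensionality => A; rewrite /dcs_expr /convex_comb big_mkcond /=.
apply: eq_bigr => i _; case: ifP => [/val[_]|_]; last by rewrite mul0r.
by rewrite FiP => ->.
Qed.
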